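(* Let $X$ be a graph and $a$ a vertex of $X$. Then the product of the elements of $\Phi_a^0$ divides the number of spanning trees of $X$.
   Context: Let $L=D-A$ be the Laplacian of $X$ with spectral decomposition $L=\sum_r\mu_rF_r$ ($\mu_r$ the distinct eigenvalues, $F_r$ the orthogonal projection onto the $\mu_r$-eigenspace). The eigenvalue support of $a$ is $\Phi_a=\{\mu_r: F_re_a\neq 0\}$, and $\Phi_a^0$ is its complement in the set of distinct eigenvalues of $L$, i.e. $\Phi_a^0=\{\mu_r:F_re_a=0\}$. *)

(* Defs.v *)
From mathcomp Require Import all_boot all_order all_algebra.
From mathcomp Require Import boolp classical_sets functions cardinality fsbigop reals.
From mathcomp Require Import finmap.

Set Implicit Arguments.
Unset Strict Implicit.
Unset Printing Implicit Defensive.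

Import Order.TTheory GRing.Theory Num.Theory.

Local Open Scope ring_scope.

(* A finite simple graph is a symmetric irreflexive relation [e : rel T] on a
   finite type [T] of vertices; an edge is the two-element set of its ends. *)
Section SpanningTrees.
Variable T : finType.
Implicit Types (e r : rel T) (F : {set {set T}}).

Definition edges e : {set {set T}} :=
  [set [set p.1; p.2] | p : T * T & e p.1 p.2].

Definition edge_rel F : rel T := [rel x y | [set x; y] \in F].

Definition connected_rel r : bool := [forall x, forall y, connect r x y].

(* Cycles have no repeated vertex, so bounding their length by #|T| loses
   nothing (see acyclicP). *)
Definition acyclic r : bool :=
  [forall k : 'I_#|T|.+1, forall c : k.-tuple T, (2 < k)%N ==> ~~ ucycleb r c].

Lemma acyclicP r :
  reflect (forall c : seq T, (2 < size c)%N -> ~ ucycle r c) (acyclic r).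
Proof.
apply: (iffP forallP) => [acr c c2 rc | acr k].
  have cT : (size c < #|T|.+1)%N.
    by case/andP: rc => _ /card_uniqP <-; rewrite ltnS max_card.
  have /forallP/(_ (in_tuple c))/implyP/(_ c2)/negP := acr (Ordinal cT).
  exact.
apply/forallP => c; apply/implyP => k2; apply/negP.
by apply: acr; rewrite size_tuple.
Qed.

Definition spanning_tree e F : bool :=
  [&& F \subset edges e, connected_rel (edge_rel F) & acyclic (edge_rel F)].

Definition num_spanning_trees e : nat := #|[set F | spanning_tree e F]|.

End SpanningTrees.

Section Laplacian.
Variables (R : realType) (T : finType).
Implicit Types (e : rel T) (a : T).

Definition adjacency_mx e : 'M[R]_#|T| :=
  \matrix_(i, j) (e (enum_val i) (enum_val j))%:R.

Definition degree_mx e : 'M[R]_#|T| :=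
  diag_mx (\row_i #|e (enum_val i)|%:R).

Definition laplacian_mx e : 'M[R]_#|T| := degree_mx e - adjacency_mx e.

Definition vertex_vec a : 'cV[R]_#|T| := delta_mx (enum_rank a) 0.

End Laplacian.

Section OrthogonalProjection.
Variables (R : realType) (n : nat).

(* [kermx U^T] is the orthogonal complement of the row space of [U]. *)
Definition orthoproj (U : 'M[R]_n) : 'M[R]_n := proj_mx U (kermx U^T).

Lemma orthocomp_cap (U : 'M[R]_n) : (U :&: kermx U^T = 0)%MS.
Proof.
apply/eqP/rowV0P => v; rewrite sub_capmx => /andP[/submxP[w ->]].
move/sub_kermxP => H.
have : (w *m U) *m (w *m U)^T = 0 by rewrite trmx_mul mulmxA H mul0mx.
move: (w *m U) => x /matrixP/(_ 0 0); rewrite !mxE => /eqP.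
rewrite psumr_eq0 => [/allP v0|j _]; last by rewrite mxE -expr2 sqr_ge0.
apply/rowP => j; have := v0 j (mem_index_enum j).
by rewrite !mxE mulf_eq0 orbb => /eqP.
Qed.

Lemma orthocomp_full (U : 'M[R]_n) : (1%:M <= U + kermx U^T)%MS.
Proof.
rewrite sub1mx /row_full mxrank_disjoint_sum ?orthocomp_cap //.
by rewrite mxrank_ker mxrank_tr subnKC // rank_leq_row.
Qed.

(* [orthoproj U] is the orthogonal projection onto the row space of [U]. *)
Lemma orthoprojP (U : 'M[R]_n) (P := orthoproj U) :
  [/\ P *m P = P, P^T = P & (P == U)%MS].
Proof.
have PU : (P <= U)%MS by rewrite -[P]mul1mx proj_mx_sub.
have idU : U *m P = U by rewrite proj_mx_id ?orthocomp_cap.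
split; last by rewrite PU -{1}idU submxMl.
  exact: proj_mx_proj (orthocomp_cap U).
have /sub_kermxP := proj_mx_compl_sub (orthocomp_full U).
rewrite mul1mx -/(orthoproj U) -/P => H.
have /submxP[w Pw] := PU.
have PT : P^T = P *m P^T.
  apply/eqP; rewrite -subr_eq0 -{1}[P^T]mul1mx -mulmxBl.
  by rewrite {2}Pw trmx_mul mulmxA H mul0mx.
by rewrite PT -[LHS]trmxK trmx_mul trmxK -PT trmxK.
Qed.

End OrthogonalProjection.

Local Open Scope classical_set_scope.

Section Support.
Variables (R : realType) (T : finType).
Implicit Types (e : rel T) (a : T) (mu : R).

Definition laplacian_eigenvalues e : set R :=
  [set mu | eigenvalue (laplacian_mx R e) mu].

(* MathComp's eigenspaces consist of row vectors; [laplacian_mx R e] is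
   symmetric when [e] is, so left and right eigenvectors agree. *)
Definition eigenproj e mu : 'M[R]_#|T| :=
  orthoproj (eigenspace (laplacian_mx R e) mu).

Definition eigenvalue_support e a : set R :=
  [set mu | laplacian_eigenvalues e mu /\
            eigenproj e mu *m vertex_vec R a != 0].

Definition support_compl e a : set R :=
  laplacian_eigenvalues e `\` eigenvalue_support e a.

Lemma finite_laplacian_eigenvalues e : finite_set (laplacian_eigenvalues e).
Proof.
set p := char_poly (laplacian_mx R e).
have p0 : p != 0 by rewrite monic_neq0 ?char_poly_monic.
apply: contrapT => /(infinite_set_fset (size p)) [X XE sX].
have := max_poly_roots p0 (rs := enum_fset X) _ (fset_uniq X).
rewrite ltnNge sX => /implyP; rewrite implybF => /negP; apply.
by apply/allP => x /XE; rewrite /= /laplacian_eigenvalues /= eigenvalue_root_char.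
Qed.

Lemma finite_support_compl e a : finite_set (support_compl e a).
Proof. exact/finite_setD/finite_laplacian_eigenvalues. Qed.

End Support.

(* Main.v *)
Require Import Defs.
From mathcomp Require Import boolp classical_sets fsbigop reals.
From mathcomp Require Import all_boot all_order all_fingroup all_algebra.
From mathcomp Require Import spectral separable complex.

(** Let [phi] be the characteristic polynomial, up to sign, of the Laplacian [L]
with the row and column of [a] deleted. By the matrix-tree theorem its value at
[0] is, up to sign, the number of spanning trees. If [mu] is in the complement
of the support of [a], an eigenvector for [mu] vanishes at [a], so that deleting
its entry at [a] gives an eigenvector of the reduced Laplacian: [mu] is a root
of [phi]. Hence [q], the product of the distinct factors [X - mu], divides
[phi]. Moreover [q] has integer coefficients: it is a greatest common divisor of
two rational polynomials, and it divides the characteristic polynomial of [L],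
so Gauss's lemma applies. Evaluating at [0] gives the divisibility.

The matrix-tree theorem is obtained by expanding the rows of the determinant:
row [x <> a] of [L] is the sum of [e_x - e_y] over the neighbours [y] of [x], so
the determinant is a sum over the maps [f] sending each [x <> a] to a neighbour.
The term of [f] is [1] if iterating [f] leads every vertex to [a], that is, if
[f] is the parent map of a spanning tree rooted at [a], and [0] otherwise. *)

Set Implicit Arguments.
Unset Strict Implicit.
Unset Printing Implicit Defensive.

Import Order.TTheory GRing.Theory Num.Theory.

Local Open Scope ring_scope.

(** * Symmetric matrices and the eigenvalues whose eigenvectors vanish at a coordinate *)

(** Over the complex extension the matrix is unitarily similar to a diagonal matrix with real
    entries, whose minimal polynomial has the distinct entries as simple roots; the factorization
    descends because polynomials embed injectively. *)
Lemma mxminpoly_symmetric (R : rcfType) n (A : 'M[R]_n.+1) :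
  A^T = A ->
  exists2 rs : seq R, uniq rs & mxminpoly A = \prod_(x <- rs) ('X - x%:P).
Proof.
move=> symA; pose toC := real_complex R.
have [B_sym B_real] : map_mx toC A \is symmetricmx /\ map_mx toC A \is a realmx.
  split; first by apply/is_hermitianmxP; rewrite expr0 scale1r map_mx_id // map_trmx symA.
  by apply/mxOverP => i j; rewrite mxE complex_real.
have /orthomx_spectralP := symmetric_normalmx B_sym B_real.
have /mxOverP := hermitian_spectral_diag_real (realsym_hermsym B_sym B_real).
have := spectral_unit (map_mx toC A).
set P := spectralmx _; set d := spectral_diag _ => Punit d_real defA.
have dE i : d 0 i = toC (complex.Re (d 0 i)) by rewrite /toC RRe_real.
pose rs := undup [seq complex.Re (d 0 i) | i <- enum 'I_n.+1].
exists rs; first exact: undup_uniq.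
apply: (map_poly_inj toC).
rewrite -mxminpoly_map defA -conjVmx // mxminpoly_uconj ?unitmx_inv //.
rewrite mxminpoly_diag rmorph_prod /= (eq_map dE).
rewrite (map_comp toC) undup_map_inj; last exact: complexI.
by rewrite big_map; apply: eq_bigr => x _; rewrite rmorphB /= map_polyX map_polyC.
Qed.

(* For a simple root [mu] of a polynomial [p] annihilating [A], the resolvent
matrix below is [(p / (X - mu)).[A]], that is, [p^`().[mu]] times the projection
onto the [mu]-eigenspace. It is written as a polynomial in [mu] with
coefficients in the field of the entries of [A]. *)
Section Resolvent.
Variables (F : comNzRingType) (n : nat).
Implicit Types (A : 'M[F]_n.+1) (p : {poly F}).

Definition resolvent_mx p A mu : 'M[F]_n.+1 :=
  \sum_(j < size p) p`_j *: \sum_(k < j) mu ^+ (j.-1 - k) *: A ^+ k.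

(** Each monomial of [p] contributes the factorization of [mu ^+ j - A ^+ j] by [mu - A]. *)
Lemma mulmx_resolvent p A mu :
  (mu%:M - A) *m resolvent_mx p A mu = p.[mu]%:M - horner_mx A p.
Proof.
rewrite horner_coef -[in horner_mx A p](coefK p) poly_def !rmorph_sum /=.
rewrite -sumrB mulmx_sumr.
apply: eq_bigr => j _; rewrite linearZ /= horner_mxZ rmorphXn /= horner_mx_X.
rewrite rmorphM rmorphXn /= -scalemx1 -scalerAl mul1r -scalerBr.
congr (_ *: _); rewrite subrXX_comm; last exact: (esym (comm_mx_scalar _ _)).
congr (_ *m _); apply: eq_bigr => k _.
by rewrite -rmorphXn /= -mul_scalar_mx.
Qed.

Lemma trmx_resolvent p A mu : A^T = A ->
  (resolvent_mx p A mu)^T = resolvent_mx p A mu.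
Proof.
move=> symA; have trX k : (A ^+ k)^T = A ^+ k.
  elim: k => [|k IHk]; first by rewrite expr0 trmx1.
  by rewrite exprS trmx_mul IHk symA -exprS exprSr.
rewrite linear_sum; apply: eq_bigr => j _; rewrite linearZ /= linear_sum.
by congr (_ *: _); apply: eq_bigr => k _; rewrite linearZ /= trX.
Qed.

(** On an eigenvector [A] acts as [mu], so the inner sum becomes [j] copies of [mu ^+ j.-1], the
    derivative of the monomial. *)
Lemma eigen_mulmx_resolvent p A mu m (V : 'M[F]_(m, n.+1)) :
  V *m A = mu *: V -> V *m resolvent_mx p A mu = p^`().[mu] *: V.
Proof.
move=> VA; have VX k : V *m A ^+ k = mu ^+ k *: V.
  elim: k => [|k IHk]; first by rewrite !expr0 mulmx1 scale1r.
  by rewrite exprSr mulmxA IHk -scalemxAl VA scalerA -exprSr.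
rewrite mulmx_sumr -[X in deriv X]coefK poly_def raddf_sum horner_sum scaler_suml.
apply: eq_bigr => j _; rewrite -scalemxAr /= derivZ derivXn hornerZ -scalerA.
congr (_ *: _); rewrite hornerMn hornerXn mulmx_sumr -[X in _ *+ X]card_ord.
rewrite -sumr_const scaler_suml; apply: eq_bigr => k _.
rewrite -scalemxAr VX scalerA -exprD subnK // -ltnS prednK //.
by apply: leq_trans (ltn_ord k).
Qed.

(** With [mu] turned into the indeterminate, a gcd with [p] can be taken over the rationals even
    when the eigenvalues are irrational. *)
Definition resolvent_diag_poly p A i : {poly F} :=
  \sum_(j < size p) p`_j *: \sum_(k < j) (A ^+ k) i i *: 'X^(j.-1 - k).

Lemma horner_resolvent_diag p A i mu :
  (resolvent_diag_poly p A i).[mu] = resolvent_mx p A mu i i.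
Proof.
rewrite horner_sum summxE; apply: eq_bigr => j _.
rewrite hornerZ mxE horner_sum summxE; congr (_ * _).
by apply: eq_bigr => k _; rewrite hornerZ hornerXn mxE mulrC.
Qed.

End Resolvent.

Lemma map_resolvent_diag (F K : fieldType) (f : {rmorphism F -> K}) n p
    (A : 'M[F]_n.+1) i :
  map_poly f (resolvent_diag_poly p A i) =
  resolvent_diag_poly (map_poly f p) (map_mx f A) i.
Proof.
rewrite /resolvent_diag_poly size_map_poly rmorph_sum; apply: eq_bigr => j _ /=.
rewrite map_polyZ coef_map rmorph_sum; congr (_ *: _); apply: eq_bigr => k _ /=.
by rewrite map_polyZ map_polyXn -rmorphXn mxE.
Qed.

Lemma resolvent_diag_eq0P (R : realFieldType) n (A : 'M[R]_n.+1) p mu i :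
    A^T = A -> horner_mx A p = 0 -> root p mu -> p^`().[mu] != 0 ->
  resolvent_mx p A mu i i = 0 <->
  (forall v : 'rV_n.+1, v *m A = mu *: v -> v 0 i = 0).
Proof.
move=> symA pA /rootP pmu dp; set W := resolvent_mx p A mu.
have symW : W^T = W by apply: trmx_resolvent.
have WA : W *m A = mu *: W.
  apply: trmx_inj; rewrite trmx_mul symA linearZ /= symW; apply/eqP.
  rewrite eq_sym -subr_eq0 -mul_scalar_mx -mulmxBl mulmx_resolvent pA pmu.
  by rewrite subr0 raddf0.
split=> [Wii v /(eigen_mulmx_resolvent p)/matrixP/(_ 0 i) | v0]; last first.
  have := v0 (row i W); rewrite mxE; apply.
  by rewrite -row_mul WA linearZ.
have Wk k : W k i = 0.
  have /eqP := eigen_mulmx_resolvent p WA => /eqP/matrixP/(_ i i)/eqP.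
  rewrite !mxE -/W Wii mulr0 psumr_eq0 => [/allP W0|j _]; last first.
    by rewrite -{1}symW mxE -expr2 sqr_ge0.
  have := W0 k (mem_index_enum k); rewrite -{1}symW mxE mulf_eq0 orbb.
  by move/eqP.
rewrite !mxE big1 => [/eqP|j _]; last by rewrite Wk mulr0.
by rewrite eq_sym mulf_eq0 (negbTE dp) => /eqP.
Qed.

Lemma vanishing_eigenvalues_int_poly (R : rcfType) n (A : 'M[int]_n) (i : 'I_n)
    (AR := map_mx intr A : 'M[R]_n) :
  A^T = A ->
  exists q : {poly int}, exists s : seq R,
    [/\ uniq s, map_poly intr q = \prod_(x <- s) ('X - x%:P) &
      forall mu, mu \in s <-> eigenvalue AR mu /\
        forall v : 'rV_n, v *m AR = mu *: v -> v 0 i = 0].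
Proof.
case: n => [|n] in A i AR *; first by case: i.
move=> symA; pose AQ := map_mx intr A : 'M[rat]_n.+1.
have ARE : AR = map_mx ratr AQ.
  by apply/matrixP => j k; rewrite !mxE ratr_int.
have symAR : AR^T = AR by rewrite /AR map_trmx symA.
have [rs rs_uniq pRE] := mxminpoly_symmetric symAR.
(* The product sought is [gcdp p w]: the roots of [p] are the eigenvalues, and
   those of them that are roots of [w] are the ones vanishing at [i]. *)
pose p := mxminpoly AQ; pose w := resolvent_diag_poly p AQ i.
pose toR := map_poly (ratr : rat -> R).
have pR : toR p = mxminpoly AR by rewrite ARE mxminpoly_map.
have gp : toR (gcdp p w) %| \prod_(x <- rs) ('X - x%:P).
  by rewrite -pRE -pR dvdp_map dvdp_gcdl.
have [m gm] := dvdp_prod_XsubC gp.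
have gchar : gcdp p w %| map_poly intr (char_poly A).
  rewrite map_char_poly; apply: dvdp_trans (dvdp_gcdl _ _) _.
  exact: mxminpoly_dvd_char.
(* Gauss's lemma: up to a rational factor the gcd is an integer polynomial [q1] dividing the monic
   [char_poly A] over the integers. *)
have [q1 [c c0 gE] [r rE]] := dvdpP_rat_int gchar.
have lead1 : lead_coef q1 * lead_coef r = 1.
  by rewrite -lead_coefM -rE; apply/monicP/char_poly_monic.
(* The integer [lead_coef r] is inverse to [lead_coef q1], so the scaled polynomial is monic;
   [mask m rs] lists the roots of the gcd. *)
exists (lead_coef r *: q1), (mask m rs); split; first exact: mask_uniq.
  apply/eqP; rewrite -eqp_monic ?monic_prod_XsubC //; last first.
    rewrite monicE lead_coef_map_inj //; last exact: intr_inj.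
    by rewrite lead_coefZ mulrC lead1.
  apply: eqp_trans gm; rewrite gE /toR !map_polyZ -map_poly_comp /=.
  rewrite (eq_map_poly (ratr_int R)).
  have l0 : (lead_coef r)%:~R != 0 :> R.
    by rewrite intr_eq0; apply: contra_eq_neq lead1 => ->; rewrite mulr0.
  by rewrite (eqp_trans (eqp_scale _ l0)) // eqp_sym eqp_scale // fmorph_eq0.
move=> mu; rewrite -root_prod_XsubC -(eqp_root gm) /toR gcdp_map root_gcd.
rewrite eigenvalue_root_min /w map_resolvent_diag -/toR pR -ARE.
have pA : horner_mx AR (mxminpoly AR) = 0 := mx_root_minpoly _.
have dp : root (mxminpoly AR) mu -> (mxminpoly AR)^`().[mu] != 0.
  apply: coprimep_root; rewrite pRE.
  by have := separable_prod_XsubC rs; rewrite rs_uniq separable_poly.unlock.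
split=> [/andP[pmu /rootP]|[pmu v0]].
  rewrite horner_resolvent_diag => W0; split => //.
  by have [+ _] := resolvent_diag_eq0P i symAR pA pmu (dp pmu); apply.
rewrite pmu /=; apply/rootP; rewrite horner_resolvent_diag.
by have [_] := resolvent_diag_eq0P i symAR pA pmu (dp pmu); apply.
Qed.

(** * Spanning trees as parent maps rooted at [a] *)

Section ParentMaps.
Variables (T : finType) (a : T).
Implicit Types (e : rel T) (f g : {ffun T -> T}) (F : {set {set T}}) (x y : T).

Lemma set2_inj x y u v : [set x; y] = [set u; v] ->
  (x = u /\ y = v) \/ (x = v /\ y = u).
Proof.
move=> E.
have /set2P hx : x \in [set u; v] by rewrite -E set21.
have /set2P hy : y \in [set u; v] by rewrite -E set22.
have /set2P hu : u \in [set x; y] by rewrite E set21.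
have /set2P hv : v \in [set x; y] by rewrite E set22.
case: hx hy => [xu|xv] [yu|yv]; auto.
- by left; split=> //; case: hv => ->; rewrite ?xu.
- by right; split=> //; case: hu => ->; rewrite ?xv.
Qed.

Lemma edges_rel e x y : symmetric e -> ([set x; y] \in edges e) = e x y.
Proof.
move=> e_sym; apply/imsetP/idP => [[[u v]]|exy]; last by exists (x, y); rewrite ?inE.
by rewrite inE /= => euv /set2_inj[[-> ->]|[-> ->]] //; rewrite e_sym.
Qed.

Lemma edge_rel_sym F : symmetric (edge_rel F).
Proof. by move=> x y; rewrite /edge_rel /= setUC. Qed.

(** In a parent map, [f a = a] fixes the value at the root, so that each tree is counted once. *)
Definition rooted f := [forall x, fconnect f x a].

Definition parent_map e f :=
  [&& f a == a, [forall x, (x != a) ==> e x (f x)] & rooted f].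

Definition parent_edges f : {set {set T}} := [set [set x; f x] | x in [set~ a]].

Lemma rooted_invariant f (P : pred T) x :
  rooted f -> (forall y, P y -> P (f y)) -> P x -> P a.
Proof.
move=> /forallP/(_ x)/iter_findex <- Pf Px.
by elim: (findex _ _ _) => //= k /Pf.
Qed.

Lemma rooted_depth f x :
  rooted f -> x != a -> findex f x a = (findex f (f x) a).+1.
Proof.
by move=> /forallP/(_ x) cxa xa; rewrite fconnect_findex // eq_sym.
Qed.

Lemma parent_edgesP f x y :
  reflect ((x != a /\ f x = y) \/ (y != a /\ f y = x))
    (edge_rel (parent_edges f) x y).
Proof.
apply: (iffP imsetP) => [[z]|[[xa <-]|[ya <-]]].
- by rewrite !inE => za /set2_inj[[-> ->]|[-> ->]]; [left | right].
- by exists x; rewrite ?inE.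
by exists y; rewrite ?inE // setUC.
Qed.

Lemma parent_edges_connected f : rooted f -> connected_rel (edge_rel (parent_edges f)).
Proof.
move=> rf; have c_a x : connect (edge_rel (parent_edges f)) x a.
  apply: contraT => nxa.
  suff: ~~ connect (edge_rel (parent_edges f)) a a by rewrite connect0.
  pose P z := ~~ connect (edge_rel (parent_edges f)) z a.
  apply: (rooted_invariant (P := P) rf) nxa => y; apply: contra => fya.
  have [->|ya] := eqVneq y a; first exact: connect0.
  by apply: connect_trans fya; apply/connect1/parent_edgesP; left.
apply/forallP => x; apply/forallP => y; apply: connect_trans (c_a x) _.
by rewrite sym_connect_sym //; apply: edge_rel_sym.
Qed.

(* Both neighbours of the deepest vertex of a cycle would be its parent. *)
Lemma parent_edges_acyclic f : rooted f -> acyclic (edge_rel (parent_edges f)).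
Proof.
move=> rf; apply/acyclicP => c c2 /andP[cyc_c uniq_c].
have [x0 x0c] : exists x, x \in c.
  by case: c c2 {cyc_c uniq_c} => // x c _; exists x; rewrite mem_head.
case: (@arg_maxnP _ x0 (mem c) (fun x => findex f x a) x0c) => x xc x_max.
have parent_nbr y : y \in c -> edge_rel (parent_edges f) x y -> f x = y.
  move=> yc /parent_edgesP[[//]|[ya fy]].
  by have := x_max y yc; rewrite /= (rooted_depth rf ya) fy ltnn.
case: (rot_to xc) c2 => k [|y [|z s]] E; rewrite -(size_rot k) E // => _.
have memE u : u \in c = (u \in [:: x, y, z & s]) by rewrite -E mem_rot.
move: uniq_c cyc_c; rewrite -(rot_uniq k) -(rot_cycle k) E /=.
rewrite !inE !negb_or => /and4P[_ /andP[yz ys] zs _] /and3P[xy yz' zx].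
have fxy : f x = y by apply: parent_nbr xy; rewrite memE !inE eqxx orbT.
have : f x = last z s.
  apply: parent_nbr; first by rewrite memE !(in_cons x, in_cons y) mem_last !orbT.
  by rewrite edge_rel_sym; move: zx; rewrite rcons_path => /andP[].
rewrite fxy => yl; have := mem_last z s.
by rewrite -yl inE (negbTE yz) (negbTE ys).
Qed.

Lemma parent_map_spanning_tree e f : symmetric e ->
  parent_map e f -> spanning_tree e (parent_edges f).
Proof.
move=> e_sym /and3P[_ /forallP ef rf].
rewrite /spanning_tree parent_edges_connected // parent_edges_acyclic // !andbT.
apply/subsetP => _ /imsetP[x xa ->]; rewrite edges_rel //.
by have := ef x; rewrite !inE in xa; rewrite xa.
Qed.

(** If [f] and [g] differ at [y], the edge from [y] to [f y] comes from [g (f y) = y]. As depth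
    decreases along [f], [f (f y)] is not [y], so the maps also differ at [f y], and finally at [a],
    which both fix. *)
Lemma parent_edges_inj e :
  {in [pred f | parent_map e f] &, injective parent_edges}.
Proof.
move=> f g /and3P[/eqP fa _ rf] /and3P[/eqP ga _ rg] E.
apply/ffunP => x; apply/eqP; apply: contraT => fgx.
suff : f a != g a by rewrite fa ga eqxx.
apply: (rooted_invariant (P := fun z => f z != g z) rf) fgx => y fgy.
have ya : y != a by apply: contra_neq fgy => ->; rewrite fa ga.
have /parent_edgesP : edge_rel (parent_edges g) y (f y).
  by rewrite -E; apply/parent_edgesP; left.
case=> [[_ gy]|[fya gfy]]; first by rewrite gy eqxx in fgy.
rewrite gfy; apply/eqP => ffy.
have := rooted_depth rf fya; rewrite ffy (rooted_depth rf ya) => /eqP.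
by rewrite -addn2 -[X in X == _]addn0 eqn_add2l.
Qed.

(** The parent of a vertex is chosen among its neighbours in [F] strictly closer to [a]. Acyclicity
    of [F] then leaves room for no other edge. *)
Lemma spanning_tree_parent_map e F : symmetric e -> irreflexive e ->
  spanning_tree e F -> exists2 f, parent_map e f & parent_edges f = F.
Proof.
move=> e_sym e_irr /and3P[/subsetP Fe /forallP conF /acyclicP acF].
pose r := edge_rel F; have r_sym : symmetric r := edge_rel_sym F.
have re x y : r x y -> e x y by move=> /Fe; rewrite edges_rel.
pose walk x k := [exists p : k.-tuple T, path r x p && (last x p == a)].
have ex_walk x : exists k, walk x k.
  have /forallP/(_ a)/connectP[p pP pa] := conF x.
  exists (size p); apply/existsP; exists (in_tuple p).
  by rewrite pP pa eqxx.
pose dist x := ex_minn (ex_walk x).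
have closer x : x != a -> exists y, r x y && (dist y < dist x)%N.
  rewrite /dist; case: ex_minnP => k /existsP[p /andP[pP pa]] _ xa.
  move: p pP pa; case: k => [|k] p; first by rewrite tuple0 /= (negbTE xa).
  case/tupleP: p => y p /= /andP[rxy pP] pa; exists y; rewrite rxy.
  case: ex_minnP => l _ l_min; rewrite ltnS l_min //.
  by apply/existsP; exists p; rewrite pP.
pose f := [ffun x => if x == a then a else
                     odflt x [pick y | r x y && (dist y < dist x)%N]].
have fP x : x != a -> r x (f x) && (dist (f x) < dist x)%N.
  move=> xa; rewrite ffunE (negbTE xa); case: pickP => //= no.
  by have [y] := closer x xa; rewrite no.
have rf : rooted f.
  apply/forallP => x; have [k] := ubnP (dist x); elim: k x => // k IHk x.
  rewrite ltnS => xk; have [-> //|xa] := eqVneq x a.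
  rewrite fconnect_eqVf; apply/orP; right; apply: IHk.
  by apply: leq_trans xk; case/andP: (fP x xa).
have pf : parent_map e f.
  rewrite /parent_map rf ffunE !eqxx andbT /=; apply/forallP => x.
  by apply/implyP => /fP/andP[/re].
have sub_r : subrel (edge_rel (parent_edges f)) r.
  move=> x y /parent_edgesP[[xa <-]|[ya <-]]; first by case/andP: (fP x xa).
  by rewrite r_sym; case/andP: (fP y ya).
exists f => //; apply/setP => A; apply/idP/idP.
  by case/imsetP => x; rewrite !inE => /fP/andP[+ _] ->.
move=> AF; have /Fe/imsetP[[x y]] := AF; rewrite inE /= => exy defA.
have rxy : r x y by rewrite /r /edge_rel /= -defA.
have /forallP/(_ x)/forallP/(_ y)/connectP[p pP py] := parent_edges_connected rf.
move: pP py; case/shortenP => q qP q_uniq _ yq.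
rewrite defA -[_ \in _]/(edge_rel _ x y).
(* An empty path is excluded by irreflexivity, and a single step is the parent edge sought; a longer
   path closes up with the edge from [y] to [x] into a cycle of [F]. *)
case: q qP q_uniq yq => [|z [|u q]].
- by move=> _ _ /= xy; rewrite xy e_irr in exy.
- by move=> /= /andP[xz _] _ ->.
move=> qP q_uniq yq; case: (acF [:: x, z, u & q]) => //.
apply/andP; split; last exact: q_uniq.
rewrite /path.cycle rcons_path -/r -yq (r_sym y) rxy andbT.
by apply: sub_path qP.
Qed.

Lemma card_parent_maps e : symmetric e -> irreflexive e ->
  num_spanning_trees e = #|[set f | parent_map e f]|.
Proof.
move=> e_sym e_irr; rewrite /num_spanning_trees.
rewrite -(card_in_imset (f := parent_edges) (D := [set f | parent_map e f])).
  apply: eq_card => F; rewrite inE; apply/idP/imsetP.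
    by case/(spanning_tree_parent_map e_sym e_irr) => f pf <-; exists f; rewrite ?inE.
  by case=> f; rewrite inE => pf ->; apply: parent_map_spanning_tree.
by move=> f g; rewrite !inE; apply: parent_edges_inj.
Qed.
End ParentMaps.

(** * The matrix-tree theorem *)

Definition laplacian_int (T : finType) (e : rel T) : 'M[int]_#|T| :=
  \matrix_(i, j) (#|e (enum_val i)|%:R *+ (i == j) - (e (enum_val i) (enum_val j))%:R).

Lemma map_laplacian_int (R : realType) (T : finType) (e : rel T) :
  map_mx intr (laplacian_int e) = laplacian_mx R e.
Proof. by apply/matrixP => i j; rewrite !mxE rmorphB rmorphMn !rmorph_nat. Qed.

Lemma trmx_laplacian_int (T : finType) (e : rel T) :
  symmetric e -> (laplacian_int e)^T = laplacian_int e.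
Proof.
by move=> e_sym; apply/matrixP => i j; rewrite !mxE e_sym; case: eqVneq => [->|].
Qed.

Section MatrixTree.
Variables (T : finType) (a : T).
Implicit Types (e : rel T) (f : {ffun T -> T}).

Definition parent_mx f : 'M[int]_#|T| :=
  \matrix_(i, j) if enum_val i == a then (i == j)%:R
                 else (i == j)%:R - (f (enum_val i) == enum_val j)%:R.

(** Only the identity permutation contributes: in a nonzero term [f] agrees with [s] on the vertices
    moved by [s], so these are stable under [f]. If there were any, [a] would be one, but its unit
    row forces it to be fixed. The identity contributes [1] because [f] fixes no vertex other than,
    possibly, [a]. *)
Lemma det_parent_mx_rooted f : rooted a f -> \det (parent_mx f) = 1.
Proof.
move=> rf; rewrite /determinant (bigD1 (1%g : 'S_#|T|)) //=.
rewrite (@big1 _ _ _ 'S_#|T|) ?addr0 => [|s s1].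
  rewrite odd_perm1 mul1r big1 // => i _; rewrite mxE perm1 eqxx.
  case: eqVneq => // ia; case: eqVneq => [fi|]; last by rewrite subr0.
  suff : a == enum_val i by rewrite eq_sym (negbTE ia).
  apply: (rooted_invariant (P := pred1 (enum_val i)) rf) (eqxx (enum_val i)).
  by move=> y /= /eqP ->; rewrite fi.
have [i si] : exists i, s i != i.
  apply/existsP; apply: contraNT s1; rewrite negb_exists => /forallP s1.
  by apply/eqP/permP => i; rewrite perm1; have := s1 i; rewrite negbK => /eqP.
apply/eqP; rewrite mulf_eq0; apply/orP; right.
apply: contraT => /prodf_neq0 nz.
have step j : s j != j -> enum_val j != a /\ f (enum_val j) = enum_val (s j).
  move=> sj; have := nz j isT; rewrite mxE [j == _]eq_sym (negbTE sj).
  case: (eqVneq (enum_val j) a) => //= ja; case: (f _ =P _) => [-> //|_].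
  by rewrite subr0 eqxx.
pose P x := s (enum_rank x) != enum_rank x.
have : P a.
  apply: (rooted_invariant (P := P) rf (x := enum_val i)); last by rewrite /P enum_valK.
  move=> y Py; have [_] := step _ Py; rewrite enum_rankK => ->.
  by rewrite /P enum_valK; apply: contra_neq Py => /perm_inj.
by case/step; rewrite enum_rankK eqxx.
Qed.

(** The indicator [u] of the vertices that never reach [a] lies in the kernel, and it is nonzero. *)
Lemma det_parent_mx_unrooted f : ~~ rooted a f -> \det (parent_mx f) = 0.
Proof.
rewrite negb_forall => /existsP[x nxa].
pose u : 'cV[int]_#|T| := \col_j (~~ fconnect f (enum_val j) a)%:R.
have Mu : parent_mx f *m u = 0.
  apply/colP => i; rewrite !mxE.
  have ui (b : 'I_#|T|) : \sum_j (b == j)%:R * u j 0 = u b 0.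
    rewrite (bigD1 b) //= eqxx mul1r big1 ?addr0 // => j jb.
    by rewrite eq_sym (negbTE jb) mul0r.
  have [ia|ia] := eqVneq (enum_val i) a.
    rewrite (eq_bigr (fun j => (i == j)%:R * u j 0)).
      by rewrite ui mxE ia connect0.
    by move=> j _; rewrite mxE ia eqxx.
  rewrite (eq_bigr (fun j => (i == j)%:R * u j 0
                             - (enum_rank (f (enum_val i)) == j)%:R * u j 0)).
    by rewrite sumrB !ui !mxE enum_rankK fconnect_eqVf (negbTE ia) subrr.
  move=> j _; rewrite mxE (negbTE ia) mulrBl; congr (_ - _ * _).
  by rewrite (can2_eq (@enum_rankK _) (@enum_valK _)).
have : \adj (parent_mx f) *m (parent_mx f *m u) = 0 by rewrite Mu mulmx0.
rewrite mulmxA mul_adj_mx mul_scalar_mx => /matrixP/(_ (enum_rank x) 0).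
by rewrite !mxE enum_rankK nxa mulr1.
Qed.

(* A unit row at [a] has the effect on the determinant of deleting the row and
   the column of [a]. *)
Definition rooted_laplacian e : 'M[int]_#|T| :=
  \matrix_(i, j) if enum_val i == a then (i == j)%:R
    else laplacian_int e i j.

Lemma det_rooted_laplacian e :
  \det (rooted_laplacian e) = #|[set f | parent_map a e f]|%:R.
Proof.
(* Row [x] is the combination of the rows [M x y] with coefficients [c x y]; row [a] receives the
   single choice [y = a], so that all rows expand over the same index set. *)
pose c x y : int := (if x == a then y == a else e x y)%:R.
pose M x y z : int := if x == a then (x == z)%:R else (x == z)%:R - (y == z)%:R.
have rowE x z : \sum_y c x y * M x y z =
    if x == a then (x == z)%:R else #|e x|%:R *+ (x == z) - (e x z)%:R.
  rewrite /c /M; case: eqVneq => [->|xa].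
    rewrite (bigD1 a) //= eqxx mul1r big1 ?addr0 // => y /negbTE ->.
    by rewrite mul0r.
  rewrite (eq_bigr (fun y => (e x y)%:R * (x == z)%:R - (e x y)%:R * (y == z)%:R)).
    rewrite sumrB -mulr_suml; congr (_ - _).
      rewrite -natr_sum -[RHS]mulr_natr; congr (_%:R * _).
      rewrite -sum1_card [RHS]big_mkcond; apply: eq_bigr => y _.
      by rewrite unfold_in; case: (e x y).
    rewrite (bigD1 z) //= eqxx mulr1 big1 ?addr0 // => y /negbTE ->.
    by rewrite mulr0.
  by move=> y _; rewrite mulrBr.
have prodE (G : T -> T -> int) (s : 'S_#|T|) :
    \prod_i G (enum_val i) (enum_val (s i)) =
    \prod_x G x (enum_val (s (enum_rank x))).
  rewrite (reindex enum_rank) /=; last exact/onW_bij/enum_rank_bij.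
  by apply: eq_bigr => x _; rewrite enum_rankK.
have -> : \det (rooted_laplacian e) =
    \sum_(f : {ffun T -> T}) (\prod_x c x (f x)) * \det (parent_mx f).
  rewrite /determinant; under [RHS]eq_bigr do rewrite mulr_sumr.
  rewrite [RHS]exchange_big /=.
  apply: eq_bigr => s _.
  transitivity ((-1) ^+ s * \sum_(f : {ffun T -> T})
                  \prod_x (c x (f x) * M x (f x) (enum_val (s (enum_rank x))))).
    rewrite -(bigA_distr_bigA (fun x y => c x y * M x y (enum_val (s (enum_rank x))))) /=.
    rewrite -(prodE (fun x z => \sum_y c x y * M x y z)); congr (_ * _).
    by apply: eq_bigr => i _; rewrite !mxE rowE (inj_eq enum_val_inj).
  rewrite mulr_sumr; apply: eq_bigr => f _.
  rewrite big_split /= mulrCA; congr (_ * (_ * _)).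
  rewrite -(prodE (fun x => M x (f x))).
  by apply: eq_bigr => i _; rewrite mxE /M (inj_eq enum_val_inj).
rewrite -sum1_card natr_sum [RHS]big_mkcond /=; apply: eq_bigr => f _.
rewrite inE /parent_map; have [rf|nrf] := boolP (rooted a f); last first.
  by rewrite det_parent_mx_unrooted // mulr0 !andbF.
rewrite det_parent_mx_rooted // mulr1 andbT; case: ifPn => [/andP[fa /forallP ef]|].
  rewrite big1 // => x _; rewrite /c; have [->|xa] := eqVneq; first by rewrite fa.
  by have := ef x; rewrite xa => /= ->.
apply: contraNeq => /prodf_neq0 nz; apply/andP; split.
  by have := nz a isT; rewrite /c eqxx; case: (f a == a).
apply/forallP => x; apply/implyP => xa.
by have := nz x isT; rewrite /c (negbTE xa); case: (e x _).
Qed.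

End MatrixTree.

(** * The characteristic polynomial of the reduced Laplacian *)

Section RootedPencil.
Variables (T : finType) (a : T) (e : rel T).

(** The indeterminate is absent from the unit row at [a], so the determinant is, up to sign, the
    characteristic polynomial of the Laplacian without the row and column of [a]. *)
Definition rooted_pencil : 'M[{poly int}]_#|T| :=
  \matrix_(i, j) if enum_val i == a then (i == j)%:R
                 else (laplacian_int e i j)%:P - 'X *+ (i == j).

Definition rooted_poly : {poly int} := \det rooted_pencil.

Lemma horner0_rooted_poly : rooted_poly.[0] = \det (rooted_laplacian a e).
Proof.
rewrite -[LHS]/(horner_eval 0 rooted_poly) -det_map_mx; congr (\det _).
apply/matrixP => i j; rewrite !mxE; case: ifP => _; first by rewrite rmorph_nat.
by rewrite /= /horner_eval hornerD hornerN hornerMn hornerC hornerX mul0rn subr0.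
Qed.

(** The full vector [v] is killed by the pencil at [mu]: row [a] gives the entry of [v] at [a], and
    the other rows give the eigenvector equation, by symmetry of the Laplacian. *)
Lemma root_rooted_poly (R : realType) (mu : R) (v : 'rV_#|T|) :
    symmetric e -> v != 0 -> v *m laplacian_mx R e = mu *: v ->
    v 0 (enum_rank a) = 0 ->
  root (map_poly intr rooted_poly) mu.
Proof.
move=> e_sym v0 vL va; rewrite /root.
have -> : (map_poly intr rooted_poly).[mu] =
    (horner_eval mu \o map_poly intr) rooted_poly by [].
rewrite -det_map_mx -det_tr; apply/det0P; exists v => //.
have sum_delta j : \sum_i v 0 i * (j == i)%:R = v 0 j.
  rewrite (bigD1 j) //= eqxx mulr1 big1 ?addr0 // => i ij.
  by rewrite eq_sym (negbTE ij) mulr0.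
apply/rowP => j; rewrite !mxE.
have [ja|ja] := eqVneq (enum_val j) a.
  rewrite (eq_bigr (fun i => v 0 i * (j == i)%:R)).
    by rewrite sum_delta -[j]enum_valK ja.
  by move=> i _; rewrite !mxE ja eqxx rmorph_nat.
have /matrixP/(_ 0 j) := vL; rewrite !mxE => /eqP; rewrite -subr_eq0 => /eqP vLj.
rewrite -[RHS]vLj -[in RHS](sum_delta j) mulr_sumr -sumrB; apply: eq_bigr => i _.
rewrite mulrCA -mulrBr; congr (_ * _).
rewrite -map_laplacian_int -(trmx_laplacian_int e_sym) !mxE (negbTE ja).
rewrite /= rmorphB rmorphMn /= map_polyX map_polyC /horner_eval.
by rewrite hornerD hornerN hornerMn hornerC hornerX mulr_natr.
Qed.

End RootedPencil.

(** * The support of [a] and the divisibility *)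

(** The rows of the projection span the eigenspace, and their entries at [a] form the column that
    the projection sends [vertex_vec R a] to. *)
Lemma support_complP (R : realType) (T : finType) (e : rel T) (a : T) (mu : R) :
  support_compl e a mu <->
  eigenvalue (laplacian_mx R e) mu /\
  forall v : 'rV_#|T|, v *m laplacian_mx R e = mu *: v -> v 0 (enum_rank a) = 0.
Proof.
have [PP PT /eqmxP PU] := orthoprojP (eigenspace (laplacian_mx R e) mu).
rewrite -/(eigenproj e mu) in PP PT PU.
have vecE (A : 'M[R]_#|T|) i : (A *m vertex_vec R a) i 0 = A i (enum_rank a).
  by rewrite -colE mxE.
split=> [[eig nsupp]|[eig va]]; split=> //.
  have Pa : eigenproj e mu *m vertex_vec R a = 0.
    by apply/eqP; apply: contraT => Pa; case: nsupp.
  move=> v /eigenspaceP; rewrite -PU => /submxP[w vE].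
  have : v *m (eigenproj e mu *m vertex_vec R a) = 0 by rewrite Pa mulmx0.
  by rewrite mulmxA vE -(mulmxA w) PP -vE -colE => /matrixP/(_ 0 0); rewrite !mxE.
case=> _ /eqP; apply; apply/colP => i; rewrite vecE [RHS]mxE.
have := va (row i (eigenproj e mu)); rewrite mxE; apply.
by apply/eigenspaceP; rewrite -PU row_sub.
Qed.

(** Divisibility does not depend on the field, so it holds over the rationals; a monic polynomial is
    primitive, and Gauss's lemma applies. *)
Lemma dvdp_int_monic (R : realFieldType) (p q : {poly int}) :
  q \is monic -> map_poly (intr : int -> R) q %| map_poly intr p ->
  exists r, p = q * r.
Proof.
move=> q_monic; have toR : map_poly (intr : int -> R) =1
    map_poly ratr \o map_poly (intr : int -> rat).
  by move=> u /=; rewrite -map_poly_comp; apply/esym/eq_map_poly/ratr_int.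
rewrite !toR /= dvdp_map dvdp_rat_int => /dvdpP_int[r].
by rewrite zprimitive_monic // => ->; exists r.
Qed.

Local Open Scope classical_set_scope.
Local Open Scope ring_scope.

Theorem theorem8p2 (R : realType) (T : finType) (e : rel T)
    (e_sym : symmetric e) (e_irr : irreflexive e) (a : T) :
  exists d : int,
    \big[*%R/1]_(mu \in support_compl (R := R) e a) mu = d%:~R
    /\ (d %| (num_spanning_trees e)%:Z)%Z.
Proof.
have [q [s [s_uniq qE sP]]] :=
  vanishing_eigenvalues_int_poly R (enum_rank a) (trmx_laplacian_int e_sym).
rewrite map_laplacian_int in sP.
have -> : support_compl e a = [set` s].
  by apply/seteqP; split=> mu; rewrite /= sP => /support_complP.
(* The sign turns [q.[0]], the product of the [- mu], into the product of the [mu]. *)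
rewrite -fsbig_seq //; exists ((-1) ^+ size s * q.[0]); split.
  rewrite rmorphM rmorphXn rmorphN1 /= -[q.[0]%:~R]horner_map /= rmorph0 qE.
  rewrite horner_prod; elim: (s) => [|x t IHt]; first by rewrite !big_nil mulr1.
  rewrite !big_cons IHt hornerXsubC sub0r exprS.
  by rewrite mulN1r !mulNr mulrN opprK mulrCA.
have q_monic : q \is monic.
  have := monic_prod_XsubC s xpredT id; rewrite /= -qE !monicE.
  rewrite lead_coef_map_inj ?rmorph0 //; last exact: intr_inj.
  by rewrite (eqr_int _ _ 1).
have : map_poly intr q %| map_poly (intr : int -> R) (rooted_poly a e).
  rewrite qE; apply: uniq_roots_dvdp; last by rewrite uniq_rootsE.
  apply/allP => mu /sP[/eigenvalueP[v vL v0] va].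
  exact: root_rooted_poly e_sym v0 vL (va v vL).
case/(dvdp_int_monic q_monic) => r rE.
have := det_rooted_laplacian a e.
rewrite -horner0_rooted_poly -card_parent_maps // rE hornerM natz => <-.
(* The sign is its own inverse, so [q.[0]] is also a multiple of the signed product. *)
by apply/dvdz_mulr/dvdzP; exists ((-1) ^+ size s); rewrite signrMK.
Qed.
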